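(* Let $a\in\mathbb{R}$, $c_1>0$, $\gamma_1\in(0,1]$. (i) Let $f\colon[0,1]^d\to\mathbb{R}$ be any $(c_1,\gamma_1)$-gradient-Hölder function with level set $\{f=a\}\ne\varnothing$. Then there exists $\kappa_1>0$ such that for every accuracy $\varepsilon>0$ ($\kappa_1$ being independent of $\varepsilon$) and all $n>\kappa_1/\varepsilon^{d/(1+\gamma_1)}$, the output $S_n$ returned by the BAG algorithm (run with input $a,c_1,\gamma_1$ on $f$) after the $n$-th query is an $\varepsilon$-approximation of $\{f=a\}$. (ii) There exists $\kappa_2>0$ (independent of $\varepsilon$) such that, for every $\varepsilon>0$, no deterministic algorithm can guarantee to output an $\varepsilon$-approximation of the level set $\{f=a\}$ for all $(c_1,\gamma_1)$-gradient-Hölder functions $f\colon[0,1]^d\to\mathbb{R}$ by querying less than $\kappa_2/\varepsilon^{d/(1+\gamma_1)}$ of their values; i.e., for every deterministic algorithm and every positive integer $n<\kappa_2/\varepsilon^{d/(1+\gamma_1)}$ there is a $(c_1,\gamma_1)$-gradient-Hölder function $f$ such that the output $S_n$ of the algorithm run on $f$ is not an $\varepsilon$-approximation of $\{f=a\}$.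
   Context: $d\ge1$ is an integer. $\{f=a\}:=\{x\in[0,1]^d: f(x)=a\}$. A set $S\subseteq[0,1]^d$ is an $\varepsilon$-approximation of $\{f=a\}$ if $\{f=a\}\subseteq S\subseteq\{x\in[0,1]^d:|f(x)-a|\le\varepsilon\}$. For $E\subseteq[0,1]^d$, a function $f\colon E\to\mathbb{R}$ is $(c_1,\gamma_1)$-gradient-Hölder if it is the restriction to $E$ of a continuously differentiable function defined on $\mathbb{R}^d$ (also denoted $f$) such that $\|\nabla f(x)-\nabla f(y)\|_\infty\le c_1\|x-y\|_\infty^{\gamma_1}$ for all $x,y\in E$. Deterministic algorithm: a pair $(\varphi,\psi)$ of sequences of maps $\varphi_n\colon\mathbb{R}^{n-1}\to[0,1]^d$ and $\psi_n\colon\mathbb{R}^n\to\{\text{subsets of }[0,1]^d\}$, $n\ge1$; run on $f$, it queries $x_n=\varphi_n(f(x_1),\dots,f(x_{n-1}))$ and outputs $S_n=\psi_n(f(x_1),\dots,f(x_n))$. Bisection: for a family $\mathcal{C}$ of hypercubes in $[0,1]^d$, $\mathrm{bisect}(\mathcal{C})$ is the family obtained by subdividing each $[a_1,b_1]\times\cdots\times[a_d,b_d]\in\mathcal{C}$ into the $2^d$ hypercubes $I_1\times\cdots\times I_d$ with each $I_j$ equal to $[a_j,(a_j+b_j)/2]$ or $[(a_j+b_j)/2,b_j]$. Interpolant: for a hypercube $C'=\prod_{j=1}^d[u_j,u_j+\ell]\subseteq[0,1]^d$ with vertex set $V'=\prod_{j=1}^d\{u_j,u_j+\ell\}$, let $h_{C'}(x):=\sum_{v\in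 V'}f(v)\prod_{j=1}^d p_{v_j}(x_j)$ for $x\in C'$, where $p_{v_j}(x_j):=1-\frac{x_j-u_j}{\ell}$ if $v_j=u_j$ and $p_{v_j}(x_j):=\frac{x_j-u_j}{\ell}$ if $v_j=u_j+\ell$. BAG algorithm with input $(a,c_1,\gamma_1)$: initialize $D=[0,1]^d$, $\mathcal{C}_0=\{D\}$, $h_D\equiv a$, $n=0$. For iterations $i=1,2,\dots$: set $S(i):=\bigcup_{C\in\mathcal{C}_{i-1}}\{x\in C:|h_C(x)-a|\le c_1d\,2^{-(1+\gamma_1)(i-1)}\}$ and $\mathcal{C}_i':=\mathrm{bisect}(\mathcal{C}_{i-1})$. For each $C'\in\mathcal{C}_i'$, for each vertex $v$ of $C'$: increase $n$ by $1$, query $x_n:=v$, observe $f(x_n)$, output $S_n:=S(i)$; then form the interpolant $h_{C'}$. After all $C'\in\mathcal{C}'_i$ are processed, set $\mathcal{C}_i:=\{C'\in\mathcal{C}_i':\exists x\in C',\ |h_{C'}(x)-a|\le c_1d\,2^{-(1+\gamma_1)i}\}$. *)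

(* Defs.v *)
From HB Require Import structures.
From mathcomp Require Import all_boot all_order all_algebra.
From mathcomp Require Import all_classical all_reals all_analysis.
Set Implicit Arguments.
Unset Strict Implicit.
Unset Printing Implicit Defensive.
Import Order.TTheory GRing.Theory Num.Theory.
Import numFieldNormedType.Exports.
Local Open Scope classical_set_scope.
Local Open Scope ring_scope.

(* R^d is 'rV[R]_d, whose library norm `|x| is the sup norm.  A function on
   [0,1]^d is represented by a total function on 'rV[R]_d; every notion below
   only depends on its values on [0,1]^d. *)

Definition unit_cube (R : realType) (d : nat) : set 'rV[R]_d :=
  [set x | forall j, 0 <= x 0 j <= 1].
Arguments unit_cube : clear implicits.

Definition level_set (R : realType) (d : nat) (f : 'rV[R]_d -> R) (a : R) :
    set 'rV[R]_d :=
  [set x | unit_cube R d x /\ f x = a].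

Definition eps_approximation (R : realType) (d : nat) (f : 'rV[R]_d -> R)
    (a eps : R) (S : set 'rV[R]_d) : Prop :=
  level_set f a `<=` S /\
  S `<=` [set x | unit_cube R d x /\ `|f x - a| <= eps].

Definition gradient (R : realType) (d : nat) (g : 'rV[R]_d -> R)
    (x : 'rV[R]_d) : 'rV[R]_d :=
  \row_j 'D_(delta_mx 0 j) g x.

Definition continuously_differentiable (R : realType) (d : nat)
    (g : 'rV[R]_d -> R) : Prop :=
  (forall x, differentiable g x) /\ continuous (gradient g).

Definition gradient_holder (R : realType) (d : nat) (c1 gamma1 : R)
    (E : set 'rV[R]_d) (f : 'rV[R]_d -> R) : Prop :=
  exists g : 'rV[R]_d -> R,
    [/\ continuously_differentiable g,
        {in E, f =1 g} &
        forall x y, E x -> E y ->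
          `|gradient g x - gradient g y| <= c1 * `|x - y| `^ gamma1].

(* [query A n] is the map R^n -> [0,1]^d choosing the (n+1)-st query point, and
   [output A n] is the map applied after n queries; the value of [output A 0]
   is never used. *)
Record det_algorithm (R : realType) (d : nat) := DetAlgorithm {
  query : forall n, n.-tuple R -> 'rV[R]_d;
  output : forall n, n.-tuple R -> set 'rV[R]_d;
  query_in_cube : forall n (t : n.-tuple R), unit_cube R d (query t);
  output_in_cube : forall n (t : n.-tuple R), output t `<=` unit_cube R d
}.

Fixpoint observations (R : realType) (d : nat) (A : det_algorithm R d)
    (f : 'rV[R]_d -> R) (n : nat) : n.-tuple R :=
  if n is m.+1 then
    let t := observations A f m in [tuple of rcons t (f (query A t))]
  else [tuple].

Definition algorithm_output (R : realType) (d : nat) (A : det_algorithm R d)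
    (f : 'rV[R]_d -> R) (n : nat) : set 'rV[R]_d :=
  output A (observations A f n).

Record hypercube (R : realType) (d : nat) := Hypercube {
  corner : 'rV[R]_d;
  side : R
}.

Definition cube_set (R : realType) (d : nat) (C : hypercube R d) :
    set 'rV[R]_d :=
  [set x | forall j, corner C 0 j <= x 0 j <= corner C 0 j + side C].

(* Vertices of a hypercube are indexed by b : {ffun 'I_d -> bool}, where b j
   tells whether the j-th coordinate is the upper one. *)
Definition vertex (R : realType) (d : nat) (C : hypercube R d)
    (b : {ffun 'I_d -> bool}) : 'rV[R]_d :=
  \row_j (corner C 0 j + (if b j then side C else 0)).

Definition bisect_cube (R : realType) (d : nat) (C : hypercube R d) :
    seq (hypercube R d) :=
  let half := Hypercube (corner C) (side C / 2) in
  [seq Hypercube (vertex half b) (side C / 2) | b <- enum {ffun 'I_d -> bool}].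

Definition bisect (R : realType) (d : nat) (Cs : seq (hypercube R d)) :
    seq (hypercube R d) :=
  flatten [seq bisect_cube C | C <- Cs].

Definition interpolant (R : realType) (d : nat) (f : 'rV[R]_d -> R)
    (C : hypercube R d) (x : 'rV[R]_d) : R :=
  \sum_(b : {ffun 'I_d -> bool}) f (vertex C b) *
    \prod_(j < d) (let t := (x 0 j - corner C 0 j) / side C in
                   if b j then t else 1 - t).

(* The function h_C for C in the i-th family: the constant a on the initial
   cube, the interpolant of f afterwards. *)
Definition bag_approximant (R : realType) (d : nat) (a : R)
    (f : 'rV[R]_d -> R) (i : nat) (C : hypercube R d) : 'rV[R]_d -> R :=
  if i is 0%N then cst a else interpolant f C.

Definition bag_selected (R : realType) (d : nat) (a c1 gamma1 : R)
    (f : 'rV[R]_d -> R) (i : nat) (C : hypercube R d) : set 'rV[R]_d :=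
  [set x | cube_set C x /\
    `|bag_approximant a f i C x - a| <=
      c1 * d%:R * 2 `^ (- ((1 + gamma1) * i%:R))].

(* The families C_i, as lists of hypercubes; [bag_selected .. i C] is the set of
   points x of C such that |h_C(x) - a| <= c1 d 2^(-(1 + gamma1) i). *)
Fixpoint bag_family (R : realType) (d : nat) (a c1 gamma1 : R)
    (f : 'rV[R]_d -> R) (i : nat) : seq (hypercube R d) :=
  if i is k.+1 then
    [seq C <- bisect (bag_family a c1 gamma1 f k) |
       `[< exists x, bag_selected a c1 gamma1 f k.+1 C x >]]
  else [:: Hypercube (0 : 'rV[R]_d) 1].

(* [bag_set .. k] is the set S(k.+1) output throughout iteration k.+1. *)
Definition bag_set (R : realType) (d : nat) (a c1 gamma1 : R)
    (f : 'rV[R]_d -> R) (k : nat) : set 'rV[R]_d :=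
  \big[setU/set0]_(C <- bag_family a c1 gamma1 f k)
    bag_selected a c1 gamma1 f k C.

(* The points queried during iteration k.+1, in order; a vertex shared by
   several hypercubes is queried once for each of them. *)
Definition bag_queries (R : realType) (d : nat) (a c1 gamma1 : R)
    (f : 'rV[R]_d -> R) (k : nat) : seq 'rV[R]_d :=
  [seq vertex C b | C <- bisect (bag_family a c1 gamma1 f k),
                    b <- enum {ffun 'I_d -> bool}].

(* The successive pairs (x_n, S_n) produced by the first m iterations. *)
Definition bag_log (R : realType) (d : nat) (a c1 gamma1 : R)
    (f : 'rV[R]_d -> R) (m : nat) : seq ('rV[R]_d * set 'rV[R]_d) :=
  flatten [seq [seq (x, bag_set a c1 gamma1 f k)
                  | x <- bag_queries a c1 gamma1 f k] | k <- iota 0 m].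

(* S_n for n >= 1.  An iteration starting from a nonempty family makes at least
   one query, so the first n iterations contain the n-th query unless the family
   has become empty and the algorithm makes no further query; the default set0
   is then returned. *)
Definition bag_output (R : realType) (d : nat) (a c1 gamma1 : R)
    (f : 'rV[R]_d -> R) (n : nat) : set 'rV[R]_d :=
  (nth (0, set0) (bag_log a c1 gamma1 f n) n.-1).2.

(* Main.v *)
Require Import Defs.
From HB Require Import structures.
From mathcomp Require Import all_boot all_order all_algebra.
From mathcomp Require Import all_classical all_reals all_analysis.
From mathcomp Require Import ring lra.
Set Implicit Arguments.
Unset Strict Implicit.
Unset Printing Implicit Defensive.
Import Order.TTheory GRing.Theory Num.Theory.
Import numFieldNormedType.Exports.
Local Open Scope classical_set_scope.
Local Open Scope ring_scope.

(* Upper bound: the weights of the multilinear interpolant on a cube are a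
   probability on the vertices with mean x, so the first-order Taylor terms
   cancel and the interpolation error on a cube of side l is at most
   c1 d l^(1+gamma1).  Hence no cube meeting the level set is ever discarded,
   and |f - a| = O(2^(-(1+gamma1)k)) on the set output from the k-th family.
   That family has at most 2^(dk) cubes, so O(2^(dk)) queries suffice to reach
   this accuracy.

   Lower bound: run the algorithm on the constant function a, for which the
   only valid output is the whole cube.  If n < m^d, one of the m^d cells of
   the regular grid contains no query in its interior; a bump of height of order
   m^-(1+gamma1) supported in that cell yields the same observations, hence the
   same output, which now contains a point where |f - a| > eps. *)

(** * Mean value theorem for gradients *)

(** Classical equality and choice structures, so that membership of a hypercube in a list makes
    sense. *)
HB.instance Definition _ (R : realType) (d : nat) :=
  gen_eqMixin (hypercube R d).
HB.instance Definition _ (R : realType) (d : nat) :=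
  gen_choiceMixin (hypercube R d).

Lemma coord_le_norm (R : realType) (d : nat) (x : 'rV[R]_d) (j : 'I_d) :
  `|x 0 j| <= `|x|.
Proof.
rewrite [leRHS]mx_normrE.
exact: (le_bigmax _ (fun ij : 'I_1 * 'I_d => `|x ij.1 ij.2|) (0, j)).
Qed.

Lemma norm_le_coord (R : realType) (d : nat) (x : 'rV[R]_d) (r : R) :
  0 <= r -> (forall j, `|x 0 j| <= r) -> `|x| <= r.
Proof.
move=> r0 xr; rewrite [leLHS]mx_normrE; apply: bigmax_le => // -[i j] _ /=.
by rewrite (ord1 i).
Qed.

Lemma derive_gradient (R : realType) (d : nat) (g : 'rV[R]_d -> R)
    (y w : 'rV[R]_d) :
  differentiable g y -> 'D_w g y = \sum_j gradient g y 0 j * w 0 j.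
Proof.
move=> dg; rewrite deriveE// {1}(row_sum_delta w) linear_sum.
by apply: eq_bigr => j _; rewrite linearZ /gradient mxE deriveE//= mulrC.
Qed.

(** One-variable mean value theorem for [phi] on [[0,1]]. The intermediate point is kept on the
    segment from [x] to [v], so convexity will place it in the cube. *)
Lemma mean_value_gradient (R : realType) (d : nat) (g : 'rV[R]_d -> R)
    (x v : 'rV[R]_d) :
  (forall y, differentiable g y) ->
  exists2 t, 0 <= t <= 1 &
    g v - g x = \sum_j gradient g (x + t *: (v - x)) 0 j * (v - x) 0 j.
Proof.
move=> dg; pose w := v - x; pose phi t := g (x + t *: w).
have dphi (t : R) : is_derive t 1 phi ('D_w g (x + t *: w)).
  (* The difference quotient of [phi] at [t] is that of [g] in direction [w], so derivability and
     derivative transfer together. *)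
  have E : (fun h : R => h^-1 *: ((phi \o shift t) (h *: 1) - phi t)) =
           (fun h => h^-1 *: ((g \o shift (x + t *: w)) (h *: w)
                              - g (x + t *: w))).
    apply/funext => h; rewrite /phi /=; congr (_ *: (g _ - _)).
    by rewrite [h *: 1]mulr1 scalerDl addrCA.
  split; rewrite /derivable ?/derive E//.
  by have /diff_derivable := dg (x + t *: w); apply.
have [|t t01] := @MVT_segment R phi _ 0 1 ler01 (fun t _ => dphi t).
  by apply: derivable_within_continuous => t _; have [] := dphi t.
have vE : x + w = v by rewrite addrC subrK.
rewrite subr0 mulr1 /phi scale1r scale0r addr0 vE => ->.
by exists t; [move: t01; rewrite in_itv|rewrite derive_gradient].
Qed.

(** * Multilinear interpolation *)

Lemma big_bool_ffun (R : comPzRingType) (d : nat)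
    (F : 'I_d -> bool -> R) :
  \sum_(b : {ffun 'I_d -> bool}) \prod_j F j (b j) =
  \prod_j (F j true + F j false).
Proof.
by rewrite -bigA_distr_bigA; apply: eq_bigr => j _; rewrite big_bool.
Qed.

(** The law of [d] independent Bernoulli variables of parameters [t j], when these lie in
    [[0,1]]. *)
Definition vertex_weight (R : pzRingType) (d : nat) (t : 'I_d -> R)
    (b : {ffun 'I_d -> bool}) : R :=
  \prod_j (if b j then t j else 1 - t j).

Lemma sum_vertex_weight (R : comPzRingType) (d : nat) (t : 'I_d -> R) :
  \sum_b vertex_weight t b = 1.
Proof.
rewrite (big_bool_ffun (fun j c => if c then t j else 1 - t j)).
by rewrite big1// => j _; rewrite addrC subrK.
Qed.

Lemma vertex_weight_mean (R : comPzRingType) (d : nat) (t : 'I_d -> R)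
    (k : 'I_d) :
  \sum_b vertex_weight t b * (b k)%:R = t k.
Proof.
(* The factor [(b k)%:R] is absorbed into the [k]-th factor of the weight, so the sum still
   factorizes. *)
pose F j (c : bool) : R :=
  (if c then t j else 1 - t j) * (if j == k then c%:R else 1).
transitivity (\sum_(b : {ffun 'I_d -> bool}) \prod_j F j (b j)).
  apply: eq_bigr => b _; rewrite big_split/=; congr (_ * _).
  by rewrite -big_mkcond big_pred1_eq.
rewrite big_bool_ffun (bigD1 k)//= big1 ?mulr1.
  by rewrite /F eqxx mulr1 mulr0 addr0.
by move=> j /negbTE jk; rewrite /F jk !mulr1 addrC subrK.
Qed.

Lemma vertex_weight_ge0 (R : numDomainType) (d : nat) (t : 'I_d -> R) b :
  (forall j, 0 <= t j <= 1) -> 0 <= vertex_weight t b.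
Proof.
move=> t01; apply: prodr_ge0 => j _; have /andP[t0 t1] := t01 j.
by case: ifP; rewrite ?subr_ge0.
Qed.

Lemma vertex_in_cube (R : realType) (d : nat) (C : hypercube R d) b :
  0 <= side C -> cube_set C (vertex C b).
Proof. by move=> l0 j; rewrite mxE; case: (b j); lra. Qed.

Lemma cube_segment (R : realType) (d : nat) (C : hypercube R d)
    (x y : 'rV[R]_d) (t : R) :
  cube_set C x -> cube_set C y -> 0 <= t <= 1 -> cube_set C (x + t *: (y - x)).
Proof.
move=> Cx Cy t01 j; have := Cx j; have := Cy j; rewrite !mxE.
move: (corner C 0 j) (side C) (x 0 j) (y 0 j) => u l r s *.
apply/andP; split; nra.
Qed.

Lemma cube_dist (R : realType) (d : nat) (C : hypercube R d) (x y : 'rV[R]_d) :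
  0 <= side C -> cube_set C x -> cube_set C y -> `|x - y| <= side C.
Proof.
move=> l0 Cx Cy; apply: norm_le_coord => // j; have := Cx j; have := Cy j.
by rewrite !mxE ler_norml; lra.
Qed.

Lemma interpolation_error (R : realType) (d : nat) (c gamma : R)
    (E : set 'rV[R]_d) (g : 'rV[R]_d -> R) (C : hypercube R d) (x : 'rV[R]_d) :
  0 <= c -> 0 <= gamma -> (forall y, differentiable g y) ->
  (forall y z, E y -> E z ->
     `|gradient g y - gradient g z| <= c * `|y - z| `^ gamma) ->
  0 < side C -> cube_set C `<=` E -> cube_set C x ->
  `|interpolant g C x - g x| <= c * d%:R * side C `^ (1 + gamma).
Proof.
move=> c0 gamma0 dg gH l0 CE Cx; set l := side C.
have l0' := ltW l0.
pose t j := (x 0 j - corner C 0 j) / l.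
have t01 j : 0 <= t j <= 1.
  rewrite /t ler_pdivlMr// ler_pdivrMr// mul0r mul1r.
  by have /andP[C1 C2] := Cx j; apply/andP; split; rewrite ?subr_ge0 ?lerBlDl.
have moment (j : 'I_d) : \sum_b vertex_weight t b * (vertex C b - x) 0 j = 0.
  under eq_bigr => b _.
    rewrite [X in _ * X](_ : _ = l * (b j)%:R - l * t j); last first.
      rewrite !mxE /t mulrCA divff ?gt_eqF// mulr1 -/l.
      by case: (b j) => /=; lra.
    rewrite mulrBr mulrCA; over.
  rewrite sumrB -mulr_sumr vertex_weight_mean -mulr_suml sum_vertex_weight.
  by rewrite mul1r subrr.
have pt b : exists y, cube_set C y /\
    g (vertex C b) - g x = \sum_j gradient g y 0 j * (vertex C b - x) 0 j.
  have [s s01 E1] := mean_value_gradient x (vertex C b) dg.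
  exists (x + s *: (vertex C b - x)); split => //.
  by apply: cube_segment => //; exact: vertex_in_cube.
have {pt}[y Hy] := choice pt.
have -> : interpolant g C x - g x =
    \sum_b vertex_weight t b *
      (\sum_j (gradient g (y b) - gradient g x) 0 j * (vertex C b - x) 0 j).
  transitivity (\sum_b vertex_weight t b * (g (vertex C b) - g x)).
    under [RHS]eq_bigr do rewrite mulrBr.
    rewrite sumrB -mulr_suml sum_vertex_weight mul1r; congr (_ - _).
    by apply: eq_bigr => b _; rewrite mulrC.
  (* By the zero first moment, the gradient at [x] may be subtracted from every gradient at [y b]
     for free. *)
  have Z : \sum_b vertex_weight t b *
      (\sum_j gradient g x 0 j * (vertex C b - x) 0 j) = 0.
    under eq_bigr do rewrite mulr_sumr.
    rewrite exchange_big/= big1// => j _.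
    under eq_bigr do rewrite mulrCA.
    by rewrite -mulr_sumr moment mulr0.
  rewrite -[LHS]subr0 -[X in _ - X]Z -sumrB; apply: eq_bigr => b _.
  rewrite (Hy b).2 -mulrBr -sumrB; congr (_ * _); apply: eq_bigr => j _.
  by rewrite -mulrBl !mxE.
apply: (le_trans (ler_norm_sum _ _ _)).
set K := c * _ * _.
(* Writing [K] as a weighted average of itself reduces the bound to one vertex at a time. *)
rewrite -[K]mul1r -[X in _ <= X * K](sum_vertex_weight t) mulr_suml /K.
apply: ler_sum => b _; rewrite normrM ger0_norm ?vertex_weight_ge0//.
apply: ler_wpM2l; first exact: vertex_weight_ge0.
apply: (le_trans (ler_norm_sum _ _ _)).
(* One term per coordinate: gradient variation [c * l ^ gamma] times displacement [l]. *)
have -> : c * d%:R * l `^ (1 + gamma) =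
    \sum_(j < d) (c * l `^ gamma * l).
  rewrite sumr_const card_ord -[RHS]mulr_natr powRD.
    by rewrite powRr1//; ring.
  by apply/implyP => _; rewrite gt_eqF.
apply: ler_sum => j _; rewrite normrM; apply: ler_pM => //.
  apply: (le_trans (coord_le_norm _ _)).
  apply: (le_trans (gH _ _ (CE _ (Hy b).1) (CE _ Cx))).
  apply: ler_wpM2l => //; apply: ge0_ler_powR => //; rewrite ?nnegrE//.
  by apply: cube_dist => //; exact: (Hy b).1.
apply: (le_trans (coord_le_norm _ _)).
by apply: cube_dist => //; exact: vertex_in_cube.
Qed.

(** * The BAG algorithm *)

Lemma bisect_subset (R : realType) (d : nat) (C C' : hypercube R d) :
  0 <= side C -> C' \in bisect_cube C -> cube_set C' `<=` cube_set C.
Proof.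
move=> l0 /mapP[b _ ->] x C'x j; have := C'x j; rewrite /= mxE/=.
by case: (b j); lra.
Qed.

Lemma bisect_cover (R : realType) (d : nat) (C : hypercube R d) (x : 'rV[R]_d) :
  cube_set C x -> exists2 C', C' \in bisect_cube C & cube_set C' x.
Proof.
move=> Cx; pose b := [ffun j => corner C 0 j + side C / 2 <= x 0 j].
eexists; first by apply: (map_f _ (mem_enum _ b)).
move=> j; have := Cx j; rewrite /= !mxE/= ffunE.
by case: (leP (corner C 0 j + side C / 2) (x 0 j)); lra.
Qed.

Lemma size_bisect (R : realType) (d : nat) (Cs : seq (hypercube R d)) :
  size (bisect Cs) = (2 ^ d * size Cs)%N.
Proof.
elim: Cs => [|C Cs IH]; first by rewrite muln0.
rewrite /bisect/= size_cat -/(bisect Cs) IH size_map -cardE card_ffun.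
by rewrite card_bool card_ord mulnS.
Qed.

(** Puts the selection threshold in terms of the side [2^-1 ^+ k], the form of the interpolation
    error. *)
Lemma pow2_rate (R : realType) (p : R) (k : nat) :
  2 `^ (- (p * k%:R)) = (2^-1 ^+ k) `^ p.
Proof. by rewrite mulrC -mulNr powRrM powR_invn// exprVn. Qed.

Section BagRun.
Context (R : realType) (d : nat) (a c1 gamma1 : R) (f : 'rV[R]_d -> R).
Local Notation family := (bag_family a c1 gamma1 f).

Lemma bag_family_side k C : C \in family k -> side C = 2^-1 ^+ k.
Proof.
elim: k C => [|k IH] C /=; first by rewrite inE => /eqP ->.
rewrite mem_filter => /andP[_ /flatten_mapP[C0 /IH C0k /mapP[b _ ->]]]/=.
by rewrite C0k exprSr.
Qed.

Lemma bag_family_side_gt0 k C : C \in family k -> 0 < side C.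
Proof. by move=> /bag_family_side ->; rewrite exprn_gt0// invr_gt0. Qed.

Lemma bag_family_subset k C : C \in family k -> cube_set C `<=` unit_cube R d.
Proof.
elim: k C => [|k IH] C /=.
  by rewrite inE => /eqP -> x Cx j; have := Cx j; rewrite /= mxE add0r.
rewrite mem_filter => /andP[_ /flatten_mapP[C0 C0k /(bisect_subset _)]].
move=> /(_ (ltW (bag_family_side_gt0 C0k))) CC0.
exact: (subset_trans CC0 (IH _ C0k)).
Qed.

Lemma size_bag_family k : (size (family k) <= (2 ^ k) ^ d)%N.
Proof.
elim: k => [|k IH] /=; first by rewrite exp1n.
rewrite size_filter (leq_trans (count_size _ _))// size_bisect.
by rewrite expnS expnMn leq_mul2l IH orbT.
Qed.

Hypotheses (c1_gt0 : 0 < c1) (gamma1_gt0 : 0 < gamma1).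
Hypothesis fH : gradient_holder c1 gamma1 (unit_cube R d) f.

(** Covers all bisected cubes, before selection, because it serves to prove that a cube survives
    selection. The bound equals the selection threshold. *)
Lemma bag_approximation_error k C x : C \in bisect (family k) ->
  cube_set C x ->
  `|interpolant f C x - f x| <= c1 * d%:R * (2^-1 ^+ k.+1) `^ (1 + gamma1).
Proof.
move=> /flatten_mapP[C0 C0k CC0] Cx.
have C0s := bag_family_side_gt0 C0k.
have sC : side C = 2^-1 ^+ k.+1.
  by case/mapP: CC0 => b _ -> /=; rewrite exprSr (bag_family_side C0k).
have s0 : 0 < side C by rewrite sC exprn_gt0// invr_gt0.
have CU : cube_set C `<=` unit_cube R d.
  exact: (subset_trans (bisect_subset (ltW C0s) CC0) (bag_family_subset C0k)).
have [g [[dg _] fg gH]] := fH.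
have fgE y : cube_set C y -> f y = g y by move=> /CU Uy; apply: fg; rewrite inE.
have -> : interpolant f C x = interpolant g C x.
  by apply: eq_bigr => b _; rewrite fgE//; exact/vertex_in_cube/ltW.
by rewrite (fgE x)// -sC; apply: interpolation_error gH _ _ _ => //; exact: ltW.
Qed.

(** Induction on [k]: the subcube containing [x] passes the test at [x] itself, since [f x = a] and
    the interpolation error is within the threshold. *)
Lemma bag_family_cover k x : level_set f a x ->
  exists2 C, C \in family k & bag_selected a c1 gamma1 f k C x.
Proof.
move=> [Ux fx]; elim: k => [|k [C Ck [Cx _]]].
  exists (Hypercube 0 1); first by rewrite inE.
  split; first by move=> j; rewrite /= mxE add0r.
  by rewrite subrr normr0 mulr_ge0 ?powR_ge0// mulr_ge0// ltW.
have [C' C'C C'x] := bisect_cover Cx.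
have C'k : C' \in bisect (family k) by apply/flatten_mapP; exists C.
have sel : bag_selected a c1 gamma1 f k.+1 C' x.
  split=> //; rewrite pow2_rate/= -fx; exact: bag_approximation_error.
by exists C' => //=; rewrite mem_filter C'k andbT; apply/asboolP; exists x.
Qed.

Lemma level_set_bag_set k : level_set f a `<=` bag_set a c1 gamma1 f k.
Proof.
move=> x /(bag_family_cover k)[C Ck Cx].
by rewrite /bag_set -bigcup_seq; exists C.
Qed.

Lemma bag_set_subset k : bag_set a c1 gamma1 f k `<=` unit_cube R d.
Proof.
rewrite /bag_set -bigcup_seq => x [C Ck [Cx _]].
exact: bag_family_subset Ck _ Cx.
Qed.

(** Handles the initial family, whose approximant [a] carries no information on [f]. *)
Lemma unit_cube_bounded :
  exists M, forall x, unit_cube R d x -> `|f x - a| <= M.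
Proof.
have [g [[dg _] fg _]] := fH.
have cg : {within unit_cube R d, continuous (fun x => `|g x - a|)}.
  apply: continuous_subspaceT => x.
  have cgx : {for x, continuous (g - cst a)}.
    exact/differentiable_continuous/differentiableB.
  exact: (continuous_comp cgx (@norm_continuous _ _ _)).
have cU : compact (unit_cube R d).
  have -> : unit_cube R d = [set v | forall j, `[0, 1]%classic (v ord0 j)].
    by apply/seteqP; split => v Uv j; have := Uv j; rewrite /= in_itv.
  exact: (@rV_compact R d (fun=> `[0, 1]%classic)
    (fun=> @segment_compact R 0 1)).
have [|c _ cmax] := EVT_max_rV _ cU cg.
  by exists 0 => j; rewrite mxE lexx ler01.
exists `|g c - a| => x Ux; by rewrite fg ?inE//; apply: cmax; rewrite inE.
Qed.

Lemma bag_set_error : exists2 K, 0 < K &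
  forall k x, bag_set a c1 gamma1 f k x ->
    `|f x - a| <= K * (2^-1 ^+ k) `^ (1 + gamma1).
Proof.
have [M HM] := unit_cube_bounded.
have cd0 : 0 <= c1 * d%:R by rewrite mulr_ge0// ltW.
(* [M] serves [k = 0]; twice [c1 * d%:R] is threshold plus interpolation error for later [k]; the 1
   ensures positivity. *)
exists (`|M| + 2 * (c1 * d%:R) + 1); first by have := normr_ge0 M; lra.
move=> k x Sx; have Ux := bag_set_subset Sx.
case: k Sx => [_|k].
  rewrite expr0 powR1 mulr1; have := HM _ Ux; have := ler_norm M; lra.
rewrite /bag_set -bigcup_seq => -[C] /=.
rewrite mem_filter => /andP[_ Ck] [Cx].
rewrite pow2_rate; have := bag_approximation_error Ck Cx.
have := powR_ge0 (2^-1 ^+ k.+1) (1 + gamma1); have := normr_ge0 M.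
rewrite /=; move: (_ `^ _) => e M0 e0 H1 H2.
apply: (@le_trans _ _ (2 * (c1 * d%:R) * e)); last by apply: ler_wpM2r; lra.
by move: H1 H2; rewrite !ler_norml; lra.
Qed.

(** * Counting the queries of the BAG algorithm *)

Lemma bag_logS m :
  bag_log a c1 gamma1 f m.+1 = bag_log a c1 gamma1 f m ++
    [seq (x, bag_set a c1 gamma1 f m) | x <- bag_queries a c1 gamma1 f m].
Proof.
rewrite /bag_log; have -> : iota 0 m.+1 = iota 0 m ++ [:: m].
  by rewrite -addn1 iotaD add0n.
by rewrite map_cat flatten_cat /= cats0.
Qed.

Lemma size_bag_queries k :
  size (bag_queries a c1 gamma1 f k) = (4 ^ d * size (family k))%N.
Proof.
rewrite /bag_queries size_allpairs size_bisect -cardE card_ffun card_bool.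
by rewrite card_ord mulnAC -expnMn.
Qed.

(** A geometric sum: the new queries at most double the bound, and [2 <= 2 ^ d] as [d] is
    positive. *)
Lemma size_bag_log m :
  (0 < d)%N -> (size (bag_log a c1 gamma1 f m) <= 4 ^ d * (2 ^ m) ^ d)%N.
Proof.
move=> d0; elim: m => [//|m IH].
rewrite bag_logS size_cat size_map size_bag_queries.
apply: (@leq_trans (4 ^ d * (2 * (2 ^ m) ^ d))).
  by rewrite mul2n -addnn mulnDr leq_add// leq_mul2l size_bag_family orbT.
rewrite expnS expnMn !leq_mul//; exact: (@leq_pexp2l 2 1 d isT d0).
Qed.

(** Here [k.+1] is the iteration that made query [i]; the second conclusion forces [k] to be large
    when [i] is. *)
Lemma bag_log_nth m i : (i < size (bag_log a c1 gamma1 f m))%N ->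
  exists2 k, (nth (0, set0) (bag_log a c1 gamma1 f m) i).2 =
             bag_set a c1 gamma1 f k &
             (i < size (bag_log a c1 gamma1 f k.+1))%N.
Proof.
elim: m => [//|m IH]; rewrite [in X in (i < X)%N -> _]bag_logS.
move=> im; rewrite bag_logS nth_cat; case: ifPn => [/IH//|nim].
exists m; last by rewrite bag_logS.
move: im; rewrite size_cat size_map -leqNgt in nim * => im.
by rewrite (nth_map 0)// ltn_subLR.
Qed.

Hypothesis fa : level_set f a !=set0.

(** A point of the level set keeps every family nonempty, so each iteration makes a query and the
    default [set0] is never returned. *)
Lemma leq_size_bag_log m : (m <= size (bag_log a c1 gamma1 f m))%N.
Proof.
elim: m => [//|m IH]; rewrite bag_logS size_cat size_map -addn1.
rewrite leq_add// size_bag_queries muln_gt0 expn_gt0/=.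
have [x /(bag_family_cover m)[C]] := fa.
by case: (family m).
Qed.

Lemma bag_output_set n : (0 < d)%N -> (0 < n)%N -> exists2 k,
  bag_output a c1 gamma1 f n = bag_set a c1 gamma1 f k &
  (n <= 4 ^ d * (2 ^ k.+1) ^ d)%N.
Proof.
move=> d0 n0; have [|k E kn] := @bag_log_nth n n.-1.
  by rewrite prednK// leq_size_bag_log.
exists k => //; apply: (leq_trans _ (size_bag_log k.+1 d0)).
by rewrite prednK in kn.
Qed.

Lemma bag_upper_bound : (0 < d)%N -> exists kappa1 : R, 0 < kappa1 /\
  forall eps : R, 0 < eps ->
  forall n : nat, kappa1 / eps `^ (d%:R / (1 + gamma1)) < n%:R ->
    eps_approximation f a eps (bag_output a c1 gamma1 f n).
Proof.
move=> d0; set p := 1 + gamma1; have p0 : 0 < p by rewrite addr_gt0.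
have q0 : 0 < d%:R / p by rewrite divr_gt0// ltr0n.
have [K K0 HK] := bag_set_error.
(* [8 ^+ d] is [4 ^ d] queries per cube times [2 ^ d] for having [k.+1] rather than [k] in the
   count. *)
exists (8 ^+ d * K `^ (d%:R / p)); split.
  by rewrite mulr_gt0// ?exprn_gt0// powR_gt0.
move=> eps eps0 n; rewrite ltr_pdivrMr ?powR_gt0// => Hn.
have n0 : (0 < n)%N.
  rewrite lt0n; apply: contraTneq Hn => ->.
  by rewrite mul0r -leNgt mulr_ge0// ?exprn_ge0// powR_ge0.
have [k -> nk] := bag_output_set d0 n0; split; first exact: level_set_bag_set.
move=> x Sx; split; first exact: bag_set_subset Sx.
apply: (le_trans (HK _ _ Sx)).
pose t : R := 2 ^+ k; have t0 : 0 < t by rewrite exprn_gt0.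
have -> : (2^-1 ^+ k) `^ p = (t `^ p)^-1.
  by rewrite exprVn -powR_inv1 ?exprn_ge0// -powRrM mulN1r powRN.
(* If the error bound exceeded [eps], then [t ^+ d] would be below [(K / eps) ^ (d / p)], and
   [n <= 8 ^+ d * t ^+ d] would contradict [Hn]. *)
rewrite ler_pdivrMr ?powR_gt0// leNgt; apply/negP => KH.
have : (eps * t `^ p) `^ (d%:R / p) < K `^ (d%:R / p).
  by apply: gt0_ltr_powR => //; rewrite nnegrE ?mulr_ge0 ?powR_ge0// ltW.
rewrite powRM ?powR_ge0 ?ltW// -powRrM mulrCA divff ?gt_eqF// mulr1.
rewrite powR_mulrn ?ltW// => {}KH.
have : (n%:R : R) <= 8 ^+ d * t ^+ d.
  rewrite /t -!natrX -natrM ler_nat (leq_trans nk)// expnS expnMn mulnA.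
  by rewrite -expnMn.
rewrite leNgt => /negP; apply.
rewrite -(ltr_pM2r (powR_gt0 (d%:R / p) eps0)); apply: le_lt_trans Hn.
by rewrite -mulrA ler_wpM2l ?exprn_ge0// mulrC ltW.
Qed.
End BagRun.

(** * Bumps *)

(** In all four sign cases the first-order remainder is at most [h ^+ 2], so the quotient is within
    [|h|] of the limit. *)
Lemma is_derive_sqr_max (R : realType) (u : R) :
  is_derive u 1 (fun v : R => Num.max 0 v ^+ 2) (2 * Num.max 0 u).
Proof.
have cv : h^-1 *: (((fun v : R => Num.max 0 v ^+ 2) \o shift u) (h *: (1 : R))
    - Num.max 0 u ^+ 2) @[h --> 0^'] --> 2 * Num.max 0 u.
  apply/cvgrPdist_lt => e e0; near=> h.
  have h0 : h != 0 by near: h; exact: nbhs_dnbhs_neq.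
  have he : `|h| < e.
    by near: h; apply: dnbhs0_lt.
  apply: le_lt_trans he; rewrite /= [h *: 1]mulr1.
  set A := Num.max 0 u; set B := Num.max 0 (h + u).
  have -> : 2 * A - h^-1 *: (B ^+ 2 - A ^+ 2) =
      h^-1 * (2 * A * h - (B ^+ 2 - A ^+ 2)).
    by rewrite mulrBr mulrCA mulVf// mulr1.
  rewrite normrM normfV ler_pdivrMl ?normr_gt0// -normrM -expr2.
  rewrite [leRHS]ger0_norm ?sqr_ge0// ler_norml /A /B.
  by case: (leP 0 u) => ?; case: (leP 0 (h + u)) => ?; apply/andP; split; nra.
split; first by apply/cvg_ex; exists (2 * Num.max 0 u).
exact: cvg_lim cv.
Unshelve. all: end_near. Qed.

Lemma is_derive_coord (R : realType) (d : nat) (x w : 'rV[R]_d) (j : 'I_d) :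
  is_derive x w (fun y : 'rV[R]_d => y 0 j : R) (w 0 j).
Proof.
have dc := differentiable_coord x 0 j.
split; first exact: diff_derivable.
rewrite deriveE//.
(* The coordinate projection is packaged as a linear map, which is its own differential. *)
have @f : {linear 'rV[R]_d -> R}.
  by exists (fun N : 'rV[R]_d => N 0 j); do 2![eexists]; do ?[constructor];
     rewrite ?mxE// => ? *; rewrite ?mxE//; move=> ?; rewrite !mxE.
by rewrite (_ : (fun _ => _) = f)// diff_lin//; exact: coord_continuous.
Qed.

(* The square of the truncated quadratic [cap] is already C^1 with Lipschitz
   gradient, so no smooth cutoff is needed. *)
Definition cap (R : realType) (d : nat) (y : 'rV[R]_d) : R :=
  Num.max 0 (1 - \sum_j y 0 j ^+ 2).

Definition bump (R : realType) (d : nat) (a A r : R) (c x : 'rV[R]_d) : R :=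
  a + A * cap (r^-1 *: (x - c)) ^+ 2.

(** Chain rule through [P] and [q]; the 4 is 2 from the outer square times 2 from the quadratic. *)
Lemma bump_is_derive (R : realType) (d : nat) (a A r : R) (c x w : 'rV[R]_d) :
  differentiable (bump a A r c) x /\
  'D_w (bump a A r c) x = - (4 * A / r) *
    (cap (r^-1 *: (x - c)) * \sum_j (r^-1 *: (x - c)) 0 j * w 0 j).
Proof.
pose q : 'rV[R]_d -> R :=
  cst 1 - \sum_(j < d)
    (r^-1 *: ((fun y : 'rV[R]_d => y 0 j : R) - cst (c 0 j))) ^+ 2.
pose P (v : R) := Num.max 0 v ^+ 2.
have qE y : q y = 1 - \sum_j (r^-1 *: (y - c)) 0 j ^+ 2.
  rewrite /q fctE/= fct_sumE; congr (_ - _); apply: eq_bigr => j _.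
  by rewrite !fctE !mxE.
have bE : bump a A r c = cst a + A *: (P \o q).
  by apply/funext => y; rewrite /bump !fctE/= qE.
have dq : differentiable q x.
  apply: differentiableB => //; apply: differentiable_sum => j.
  apply/differentiableX/differentiableZ/differentiableB => //.
  exact: differentiable_coord.
have [dP1 dP2] := is_derive_sqr_max (q x).
have dP : differentiable P (q x) by exact/derivable1_diffP.
have dPq : differentiable (P \o q) x by exact: differentiable_comp.
rewrite bE; split.
  by apply: differentiableD; [exact: differentiable_cst|exact: differentiableZ].
have DPq : 'D_w (P \o q) x = 2 * Num.max 0 (q x) * 'D_w q x.
  rewrite !deriveE// diff_comp//=.
  rewrite -[X in 'd P _ X]mulr1 [X in 'd P _ X](_ : _ = 'd q x w *: (1 : R))//.
  by rewrite linearZ/= -[X in _ *: X]deriveE// dP2 [LHS]mulrC.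
rewrite deriveD; [|exact: derivable_cst|exact/derivableZ/diff_derivable].
rewrite derive_cst add0r deriveZ; last exact: diff_derivable.
rewrite DPq.
have Dq : is_derive x w q
    (0 - \sum_(j < d) (2 * r^-1 * (r^-1 *: (x - c)) 0 j * w 0 j)).
  apply: is_deriveB; apply: is_derive_sum => j.
  have H := is_derive_coord x w j.
  apply: is_derive_eq.
  rewrite !fctE !mxE subr0 expr1.
  rewrite -[LHS]/(2 * (r^-1 * (x 0 j - c 0 j)) * (r^-1 * w 0 j)).
  ring.
rewrite derive_val sub0r qE -/(cap _) [LHS]mulrA.
under eq_bigr do rewrite -mulrA.
rewrite -mulr_sumr; ring.
Qed.

Lemma cap_ge0 (R : realType) (d : nat) (y : 'rV[R]_d) : 0 <= cap y.
Proof. by rewrite /cap le_max lexx. Qed.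

Lemma cap_le1 (R : realType) (d : nat) (y : 'rV[R]_d) : cap y <= 1.
Proof.
rewrite /cap ge_max ler01 lerBlDr lerDl.
by apply: sumr_ge0 => j _; exact: sqr_ge0.
Qed.

(** The Euclidean unit ball lies in the sup-norm one; this is what fits a bump into a grid cell. *)
Lemma cap_gt0 (R : realType) (d : nat) (y : 'rV[R]_d) (j : 'I_d) :
  0 < cap y -> `|y 0 j| < 1.
Proof.
rewrite /cap lt_max ltxx/= subr_gt0 (bigD1 j)//= => h.
rewrite -(@ltr_pXn2r _ 2)// ?nnegrE// expr1n -normrX ger0_norm ?sqr_ge0//.
apply: le_lt_trans h; rewrite lerDl; apply: sumr_ge0 => i _; exact: sqr_ge0.
Qed.

Lemma cap_coord_le1 (R : realType) (d : nat) (y : 'rV[R]_d) (j : 'I_d) :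
  `|cap y * y 0 j| <= 1.
Proof.
have := cap_ge0 y; rewrite le0r => /predU1P[->|y0].
  by rewrite mul0r normr0 ler01.
rewrite normrM -[leRHS]mulr1; apply: ler_pM => //.
  by rewrite ger0_norm ?cap_le1// cap_ge0.
exact/ltW/cap_gt0.
Qed.


Lemma max0_dist (R : realDomainType) (u v : R) :
  `|Num.max 0 u - Num.max 0 v| <= `|u - v|.
Proof.
case: (leP 0 u) => u0; case: (leP 0 v) => v0 //.
- by rewrite subr0 (ger0_norm u0) (le_trans _ (ler_norm _))//; lra.
- rewrite sub0r normrN (ger0_norm v0) distrC.
  by rewrite (le_trans _ (ler_norm _))//; lra.
- by rewrite subrr normr0.
Qed.

(** Coordinates of [y] are below 1 and those of [z] below 2 in absolute value, so each difference of
    squares costs a factor 3; the product rule adds the 1. *)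
Lemma cap_coord_lipschitz (R : realType) (d : nat) (y z : 'rV[R]_d) (j : 'I_d) :
  0 < cap y -> `|y - z| <= 1 ->
  `|cap y * y 0 j - cap z * z 0 j| <= (3 * d%:R + 1) * `|y - z|.
Proof.
move=> y0 yz1.
have yz i : `|y 0 i - z 0 i| <= `|y - z|.
  by have := coord_le_norm (y - z) i; rewrite !mxE.
have dcap : `|cap y - cap z| <= 3 * d%:R * `|y - z|.
  apply: (le_trans (max0_dist _ _)).
  have -> : 1 - \sum_i y 0 i ^+ 2 - (1 - \sum_i z 0 i ^+ 2) =
      \sum_i (z 0 i ^+ 2 - y 0 i ^+ 2) by rewrite sumrB; ring.
  apply: (le_trans (ler_norm_sum _ _ _)).
  have -> : 3 * d%:R * `|y - z| = \sum_(i < d) (`|y - z| * 3).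
    by rewrite sumr_const card_ord -[RHS]mulr_natr; ring.
  apply: ler_sum => i _; rewrite distrC subr_sqr normrM ler_pM//.
  apply: (le_trans (ler_normD _ _)).
  have := cap_gt0 i y0; have := yz i; have := ler_dist_dist (z 0 i) (y 0 i).
  by rewrite (distrC (z 0 i)); have := ler_norm (`|z 0 i| - `|y 0 i|); lra.
have -> : cap y * y 0 j - cap z * z 0 j =
    (cap y - cap z) * y 0 j + cap z * (y 0 j - z 0 j) by ring.
apply: (le_trans (ler_normD _ _)); rewrite !normrM mulrDl mul1r; apply: lerD.
  apply: (le_trans _ dcap); rewrite -[leRHS]mulr1 ler_pM//.
  exact/ltW/cap_gt0.
rewrite -[leRHS]mul1r ler_pM// ger0_norm ?cap_ge0//; exact: cap_le1.
Qed.

(** At distance above 1 the left side is at most 2 and the right side at least 4. Below, the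
    Lipschitz bound suffices because [s <= s ^ gamma] on [[0,1]], with [y] and [z] swapped if only
    [cap z] is positive. *)
Lemma cap_coord_holder (R : realType) (d : nat) (gamma : R) (y z : 'rV[R]_d)
    (j : 'I_d) : 0 < gamma <= 1 ->
  `|cap y * y 0 j - cap z * z 0 j| <= (3 * d%:R + 1) * `|y - z| `^ gamma.
Proof.
move=> /andP[g0 g1].
have d1 : 1 <= d%:R :> R by rewrite ler1n; case: d j {y z} => [[]|].
case: (leP `|y - z| 1) => yz; last first.
  have : 1 <= `|y - z| `^ gamma.
    by rewrite -(powRr0 `|y - z|) ler_powR ?ltW.
  have := ler_normB (cap y * y 0 j) (cap z * z 0 j).
  have := cap_coord_le1 y j; have := cap_coord_le1 z j.
  by move: (_ `^ _) => e *; nra.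
apply: (@le_trans _ _ ((3 * d%:R + 1) * `|y - z|)); last first.
  apply: ler_wpM2l; first lra.
  have := normr_ge0 (y - z); rewrite le0r => /predU1P[->|yz0].
    by rewrite powR0// gt_eqF.
  by apply: ger1_powR; rewrite ?yz0.
have := cap_ge0 y; rewrite le0r => /predU1P[y0|y0].
  have := cap_ge0 z; rewrite le0r => /predU1P[z0|z0].
    by rewrite y0 z0 !mul0r subrr normr0 mulr_ge0//; lra.
  by rewrite distrC (distrC y) cap_coord_lipschitz// distrC.
exact: cap_coord_lipschitz.
Qed.

Lemma gradient_bumpE (R : realType) (d : nat) (a A r : R) (c x : 'rV[R]_d)
    (j : 'I_d) :
  gradient (bump a A r c) x 0 j = - (4 * A / r) *
    (cap (r^-1 *: (x - c)) * (r^-1 *: (x - c)) 0 j).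
Proof.
rewrite mxE (bump_is_derive _ _ _ _ _ _).2 (bigD1 j)//= big1 ?addr0.
  by rewrite [delta_mx _ _ _ _]mxE !eqxx mulr1.
by move=> i ij; rewrite [delta_mx _ _ _ _]mxE (negbTE ij) andbF mulr0.
Qed.

(** Scaling: [1 / r] from the gradient and [r ^ (- gamma)] from the rescaled distance. *)
Lemma bump_gradient_dist (R : realType) (d : nat) (a A r gamma : R)
    (c x y : 'rV[R]_d) : 0 <= A -> 0 < r -> 0 < gamma <= 1 ->
  `|gradient (bump a A r c) x - gradient (bump a A r c) y| <=
    4 * (3 * d%:R + 1) * A / r `^ (1 + gamma) * `|x - y| `^ gamma.
Proof.
move=> A0 r0 g01; have [g0 g1] := andP g01.
have K0 : 0 <= 4 * (3 * d%:R + 1) * A :> R.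
  by rewrite !mulr_ge0// addr_ge0// mulr_ge0.
apply: norm_le_coord => [|j].
  by rewrite mulr_ge0 ?powR_ge0// divr_ge0// powR_ge0.
rewrite mxE [X in _ + X]mxE !gradient_bumpE -mulrBr normrM normrN.
have Ar0 : 0 <= 4 * A / r by rewrite divr_ge0 ?mulr_ge0// ltW.
rewrite (ger0_norm Ar0).
have := cap_coord_holder (r^-1 *: (x - c)) (r^-1 *: (y - c)) j g01.
have -> : `|r^-1 *: (x - c) - r^-1 *: (y - c)| = r^-1 * `|x - y|.
  rewrite -scalerBr opprB addrA subrK normrZ gtr0_norm//.
  by rewrite invr_gt0.
have ri0 : 0 <= r^-1 by rewrite invr_ge0 ltW.
rewrite powRM// => H.
have -> : r `^ (1 + gamma) = r * r `^ gamma.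
  by rewrite powRD ?(gt_eqF r0) ?implybT// powRr1// ltW.
have rg : r `^ gamma != 0 by rewrite gt_eqF// powR_gt0.
have -> : 4 * (3 * d%:R + 1) * A / (r * r `^ gamma) * `|x - y| `^ gamma =
    4 * A / r * ((3 * d%:R + 1) * (r^-1 `^ gamma * `|x - y| `^ gamma)).
  have -> : r^-1 `^ gamma = (r `^ gamma)^-1.
    by rewrite -powR_inv1 ?ltW// -powRrM mulN1r powRN.
  by field; rewrite rg gt_eqF.
exact: ler_wpM2l.
Qed.

Lemma bump_gradient_holder (R : realType) (d : nat) (a A r c1 gamma : R)
    (E : set 'rV[R]_d) (c : 'rV[R]_d) : 0 <= A -> 0 < r -> 0 < gamma <= 1 ->
  4 * (3 * d%:R + 1) * A <= c1 * r `^ (1 + gamma) ->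
  gradient_holder c1 gamma E (bump a A r c).
Proof.
move=> A0 r0 g01 hA; exists (bump a A r c); split => //.
- split=> [x|]; first by have [] := bump_is_derive a A r c x 0.
  move=> x; apply/(@cvgrPdist_lt _ _ _ (nbhs x) (nbhs_filter x)) => e e0.
  (* Exponent 1 in the estimate makes the gradient Lipschitz, hence continuous; [K + 1] avoids
     dividing by 0 when [A = 0]. *)
  set K := 4 * (3 * d%:R + 1) * A / r `^ (1 + 1).
  have K0 : 0 <= K.
    by rewrite divr_ge0 ?powR_ge0// !mulr_ge0// addr_ge0// mulr_ge0.
  have eK : 0 < e / (K + 1) by rewrite divr_gt0// ltr_wpDl.
  apply: (@filterS _ _ (nbhs_filter x) _ _ _ (nbhsx_ballx x _ eK)) => y.
  rewrite -ball_normE /= => xy.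
  have g11 : 0 < (1 : R) <= 1 by rewrite ltr01 lexx.
  apply: le_lt_trans (bump_gradient_dist a c x y A0 r0 g11) _.
  rewrite -/K powRr1//; move: xy; rewrite ltr_pdivlMr ?ltr_wpDl// => xy.
  by have := normr_ge0 (x - y); nra.
- move=> x y _ _; apply: (le_trans (bump_gradient_dist a c x y A0 r0 g01)).
  by apply: ler_wpM2r; rewrite ?powR_ge0// ler_pdivrMr// powR_gt0.
Qed.

(** * The lower bound *)

(** Queries are adaptive, but agreement along the run on [f] suffices: inductively, the run on [g]
    asks the same points. *)
Lemma eq_observations (R : realType) (d : nat) (A : det_algorithm R d)
    (f g : 'rV[R]_d -> R) (n : nat) :
  (forall k, (k < n)%N -> g (query A (observations A f k)) =
                          f (query A (observations A f k))) ->
  observations A g n = observations A f n.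
Proof.
elim: n => [//|n IH] fg /=; rewrite IH ?fg// => k kn.
by apply: fg; rewrite ltnW.
Qed.

(** Midpoint of the grid cell with lower corner [k / m] and half-side [(2 * m)^-1]. *)
Definition cell_center (R : realType) (d m : nat) (k : {ffun 'I_d -> 'I_m}) :
  'rV[R]_d := \row_j ((2 * (k j)%:R + 1) / (2 * m%:R)).

Lemma cell_center_in_cube (R : realType) (d m : nat) (k : {ffun 'I_d -> 'I_m}) :
  unit_cube R d (cell_center R k).
Proof.
move=> j; rewrite mxE; have km := ltn_ord (k j).
have m0 : 0 < m%:R :> R by rewrite ltr0n (leq_ltn_trans _ km).
have km' : (k j)%:R + 1 <= m%:R :> R by rewrite natr1 ler_nat.
have k0 : 0 <= (k j)%:R :> R by [].
by rewrite divr_ge0 ?ler_pdivrMr/=; lra.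
Qed.

Lemma cells_disjoint (R : realType) (d m : nat) (k l : {ffun 'I_d -> 'I_m})
    (x : 'rV[R]_d) :
  (forall j, `|x 0 j - cell_center R k 0 j| < (2 * m%:R)^-1) ->
  (forall j, `|x 0 j - cell_center R l 0 j| < (2 * m%:R)^-1) -> k = l.
Proof.
move=> xk xl; apply/ffunP => j; apply/val_inj/eqP.
have m0 : 0 < m%:R :> R.
  by rewrite ltr0n (leq_ltn_trans _ (ltn_ord (k j))).
have := xk j; have := xl j; rewrite !mxE /=.
rewrite !ltr_norml; set u := (2 * m%:R)^-1 => /andP[l1 l2] /andP[k1 k2].
have u0 : 0 < u by rewrite invr_gt0 mulr_gt0.
have lt1 (p q : nat) : p%:R * 2 * u < q%:R * 2 * u + 2 * u -> (p <= q)%N.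
  move=> h; rewrite -ltnS -(ltr_nat R) -natr1.
  rewrite -(ltr_pM2r u0); lra.
by rewrite eqn_leq !lt1//; lra.
Qed.

(** Pigeonhole: if every open cell held a query, choosing one would inject the [m ^ d] cells into
    [n] indices. *)
Lemma free_cell (R : realType) (d m n : nat) (x : 'I_n -> 'rV[R]_d) :
  (n < m ^ d)%N -> exists k : {ffun 'I_d -> 'I_m}, forall i,
    exists j, (2 * m%:R)^-1 <= `|x i 0 j - cell_center R k 0 j|.
Proof.
move=> nm; apply: contrapT => /forallNP occupied.
have {occupied} /choice[h hP] (k : {ffun 'I_d -> 'I_m}) : exists i, forall j,
    `|x i 0 j - cell_center R k 0 j| < (2 * m%:R)^-1.
  have /existsNP[i /forallNP hi] := occupied k; exists i => j.
  by rewrite ltNge; apply/negP; exact: hi.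
have : injective h.
  by move=> k l hkl; apply: (cells_disjoint (hP k)); rewrite hkl; exact: hP.
by move=> /leq_card; rewrite card_ffun !card_ord leqNgt nm.
Qed.

Lemma bump_outside (R : realType) (d : nat) (a A r : R) (c x : 'rV[R]_d) :
  0 < r -> (exists j, r <= `|x 0 j - c 0 j|) -> bump a A r c x = a.
Proof.
move=> r0 [j rj]; rewrite /bump.
have := cap_ge0 (r^-1 *: (x - c)); rewrite le0r => /predU1P[->|/(cap_gt0 j)].
  by rewrite expr0n mulr0 addr0.
rewrite !mxE normrM normfV (gtr0_norm r0) ltr_pdivrMl// mulr1.
by rewrite ltNge rj.
Qed.

Lemma bump_center (R : realType) (d : nat) (a A r : R) (c : 'rV[R]_d) :
  bump a A r c c = a + A.
Proof.
rewrite /bump /cap subrr scaler0 big1.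
  by rewrite subr0 (elimT max_idPr) ?ler01// expr1n mulr1.
by move=> j _; rewrite mxE expr0n.
Qed.

Lemma gradient_holder_cst (R : realType) (d : nat) (a c1 gamma : R)
    (E : set 'rV[R]_d) : 0 <= c1 -> 0 < gamma <= 1 ->
  gradient_holder c1 gamma E (cst a).
Proof.
move=> c10 g01.
(* A constant is a bump of height 0. *)
rewrite (_ : cst a = bump a 0 1 0); last first.
  by apply/funext => x; rewrite /bump mul0r addr0.
by apply: bump_gradient_holder; rewrite ?ltr01// mulr0 mulr_ge0// powR_ge0.
Qed.

(** Take the least [m] with [n < m ^ d]: then [m.-1 ^ d <= n], and [m <= 2 * m.-1] since [m] is at
    least 2. *)
Lemma grid_size (d n : nat) : (0 < d)%N -> (0 < n)%N ->
  exists2 m, (n < m ^ d)%N & (m ^ d <= 2 ^ d * n)%N.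
Proof.
move=> d0 n0; have ex : exists m, (n < m ^ d)%N.
  by exists n.+1; rewrite -[ltnLHS]expn1 (leq_trans _ (leq_pexp2l _ d0)).
have [m nm minm] := ex_minnP ex; exists m => //.
have m1 : (1 < m)%N.
  rewrite ltnNge; apply: contraL nm => m1; rewrite -leqNgt.
  by rewrite (leq_trans _ n0)// -(exp1n d) leq_exp2r.
have m'n : (m.-1 ^ d <= n)%N.
  rewrite leqNgt; apply/negP => /minm; rewrite leqNgt => /negP; apply.
  by rewrite prednK// ltnW.
rewrite (leq_trans _ (leq_mul (leqnn _) m'n))// -expnMn leq_exp2r//.
case: m m1 {nm minm m'n} => [|[|m]]//= _.
by rewrite mulSn mul1n addSn !ltnS leq_addl.
Qed.

Lemma query_lower_bound (R : realType) (d : nat) (a c1 gamma1 : R) :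
  (0 < d)%N -> 0 < c1 -> 0 < gamma1 -> gamma1 <= 1 ->
  exists kappa2 : R, 0 < kappa2 /\
  forall eps : R, 0 < eps ->
  forall (A : det_algorithm R d) (n : nat),
    (0 < n)%N -> n%:R < kappa2 / eps `^ (d%:R / (1 + gamma1)) ->
    exists f : 'rV[R]_d -> R,
      gradient_holder c1 gamma1 (unit_cube R d) f /\
      ~ eps_approximation f a eps (algorithm_output A f n).
Proof.
move=> d0 c10 g0 g1; have g01 : 0 < gamma1 <= 1 by rewrite g0.
set p := 1 + gamma1; have p0 : 0 < p by rewrite addr_gt0.
have q0 : 0 < d%:R / p by rewrite divr_gt0// ltr0n.
pose L : R := 4 * (3 * d%:R + 1).
have L0 : 0 < L by rewrite mulr_gt0// ltr_wpDl// mulr_ge0.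
have cL0 : 0 < c1 / L by rewrite divr_gt0.
(* [4 ^+ d] comes from [(2 * m) ^ d <= 4 ^ d * n], where [2 * m] is the inverse of the bump
   radius. *)
exists ((c1 / L) `^ (d%:R / p) / 4 ^+ d); split.
  by rewrite divr_gt0 ?powR_gt0 ?exprn_gt0.
move=> eps eps0 A n n0; rewrite ltr_pdivlMr ?powR_gt0// => Hn.
have [m nm mn] := grid_size d0 n0.
have m0 : 0 < m%:R :> R.
  by rewrite ltr0n lt0n; apply: contraTneq nm => ->; rewrite exp0n.
pose r : R := (2 * m%:R)^-1; have r0 : 0 < r by rewrite invr_gt0 mulr_gt0.
(* The largest height that [bump_gradient_holder] allows at radius [r]. *)
pose H := c1 / L * r `^ p.
have H0 : 0 < H by rewrite mulr_gt0 ?powR_gt0.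
have epsH : eps < H.
  rewrite ltNge; apply/negP => Heps.
  have : H `^ (d%:R / p) <= eps `^ (d%:R / p).
    by apply: ge0_ler_powR => //; rewrite ?nnegrE ltW.
  rewrite /H powRM ?powR_ge0 ?(ltW cL0)// -powRrM (mulrCA p).
  rewrite divff ?gt_eqF// mulr1.
  rewrite powR_mulrn ?(ltW r0)// => {}Heps.
  have mn' : (4 ^+ d)^-1 / n%:R <= r ^+ d.
    rewrite /r exprVn -invfM -natrM -!natrX -natrM.
    have m0' : (0 < 2 * m)%N by rewrite -(ltr0n R) natrM mulr_gt0.
    rewrite lef_pV2 ?posrE ?ltr0n ?muln_gt0 ?expn_gt0 ?n0 ?m0'//.
    rewrite ler_nat expnMn.
    by rewrite (_ : 4 = 2 * 2)%N// expnMn -mulnA leq_mul2l mn orbT.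
  have : (c1 / L) `^ (d%:R / p) * ((4 ^+ d)^-1 / n%:R) <= eps `^ (d%:R / p).
    exact: le_trans (ler_wpM2l (powR_ge0 _ _) mn') Heps.
  by rewrite mulrA ler_pdivrMr ?ltr0n// leNgt mulrC Hn.
apply: contrapT => /forallNP noF.
have approx f : gradient_holder c1 gamma1 (unit_cube R d) f ->
    eps_approximation f a eps (algorithm_output A f n).
  by move=> fH; apply: contrapT => nf; apply: (noF f).
(* The cell is chosen from the run on the constant [a], before the bump is defined. *)
have [k kfree] := @free_cell R d m n
  (fun i => query A (observations A (cst a) i)) nm.
pose f := bump a H r (cell_center R k).
have fH : gradient_holder c1 gamma1 (unit_cube R d) f.
  apply: bump_gradient_holder => //; first exact: ltW.
  by rewrite -/L /H mulrA mulrCA divff ?gt_eqF// mulr1.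
have obs : observations A f n = observations A (cst a) n.
  by apply: eq_observations => i lin; apply: bump_outside (kfree (Ordinal lin)).
(* Correctness on the constant puts the cell centre in the output; correctness on the bump excludes
   it. *)
have [full _] := approx _ (gradient_holder_cst a (unit_cube R d) (ltW c10) g01).
have [_ sub] := approx _ fH; have cc := cell_center_in_cube R k.
have : algorithm_output A f n (cell_center R k).
  by rewrite /algorithm_output obs; apply: full.
move=> /sub[_]; rewrite /f bump_center addrAC subrr add0r gtr0_norm//.
by rewrite leNgt epsH.
Qed.

Theorem theorem4 (R : realType) (d : nat) (a c1 gamma1 : R)
    (d_gt0 : (0 < d)%N) (c1_gt0 : 0 < c1)
    (gamma1_gt0 : 0 < gamma1) (gamma1_le1 : gamma1 <= 1) :
  (forall f : 'rV[R]_d -> R,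
     gradient_holder c1 gamma1 (unit_cube R d) f ->
     level_set f a !=set0 ->
     exists kappa1 : R, 0 < kappa1 /\
       forall eps : R, 0 < eps ->
       forall n : nat, kappa1 / eps `^ (d%:R / (1 + gamma1)) < n%:R ->
         eps_approximation f a eps (bag_output a c1 gamma1 f n))
  /\
  (exists kappa2 : R, 0 < kappa2 /\
     forall eps : R, 0 < eps ->
     forall (A : det_algorithm R d) (n : nat),
       (0 < n)%N -> n%:R < kappa2 / eps `^ (d%:R / (1 + gamma1)) ->
       exists f : 'rV[R]_d -> R,
         gradient_holder c1 gamma1 (unit_cube R d) f /\
         ~ eps_approximation f a eps (algorithm_output A f n)).
Proof.
split; last exact: query_lower_bound.
move=> f fH fa; exact: bag_upper_bound.
Qed.
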